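(* Let $\kappa\geq \mathfrak{s}$ be a cardinal number and let $p\in D(2)$. Then $\Sigma(D(2),p,\kappa)$ is not SHD, and its Pixley-Roy hyperspace $\mathscr{F}[\Sigma(D(2),p,\kappa)]$ is SHD.
   Context: $D(2)$ is the two-point discrete space $\{0,1\}$ and $D(2)^\kappa$ carries the product topology. For $p\in D(2)$, $\Sigma(D(2),p,\kappa)=\{x\in D(2)^\kappa : |\{\alpha\in\kappa : x(\alpha)\neq p\}|\leq\omega\}$ with the subspace topology. The splitting number $\mathfrak{s}$ is the least cardinality of a family $\mathcal{S}$ of infinite subsets of $\omega$ such that for every infinite $A\subseteq\omega$ there is $S\in\mathcal{S}$ with both $A\cap S$ and $A\setminus S$ infinite. For a topological space $X$, the Pixley-Roy hyperspace $\mathscr{F}[X]$ is the set of all non-empty finite subsets of $X$ with the topology having as a base all sets $[F,U]=\{G\in\mathscr{F}[X] : F\subseteq G\subseteq U\}$, where $F\in\mathscr{F}[X]$ and $U\subseteq X$ is open. A topological space $Y$ is SHD (selectively highly divergent) if for every sequence $(U_n)_{n\in\omega}$ of non-empty open subsets of $Y$ one can pick $x_n\in U_n$ for each $n\in\omega$ in such a way that the sequence $(x_n)$ has no convergent subsequence in $Y$. *)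

(* Defs.v *)
From HB Require Import structures.
From mathcomp Require Import all_boot finmap.
From mathcomp Require Import all_classical topology.

Set Implicit Arguments.
Unset Strict Implicit.
Unset Printing Implicit Defensive.

Local Open Scope classical_set_scope.
Local Open Scope card_scope.

(* Cardinal numbers are represented by types, and compared by means of [#=]
   and [#<=] on the corresponding full sets. *)

Definition splitting_family (S : set (set nat)) : Prop :=
  (forall B, S B -> infinite_set B) /\
  (forall A, infinite_set A ->
     exists B, [/\ S B, infinite_set (A `&` B) & infinite_set (A `\` B)]).

Definition is_splitting_number (s : Type) : Prop :=
  (exists2 S, splitting_family S & S #= [set: s]) /\
  (forall S, splitting_family S -> [set: s] #<= S).

(* [bool], with its canonical discrete topology, is D(2); [{ptws kappa -> bool}]
   carries the product topology and the coercion of a set to a type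
   ([set_type]) the subspace topology. *)
Definition Sigma_set (p : bool) (kappa : Type) : set {ptws kappa -> bool} :=
  [set x | countable [set alpha | x alpha <> p]].

Definition Sigma (p : bool) (kappa : Type) : topologicalType :=
  set_type (@Sigma_set p kappa).

Definition pixley_roy (X : topologicalType) : Type :=
  {F : {fset X} | F != fset0}.

HB.instance Definition _ (X : topologicalType) :=
  Choice.copy (pixley_roy X) {F : {fset X} | F != fset0}.

Section PixleyRoy.
Variable X : topologicalType.
Implicit Types (F G : pixley_roy X) (U : set X).

Definition pr_nbhd F U : set (pixley_roy X) :=
  [set G | (val F `<=` val G)%fset /\ [set` val G] `<=` U].

Definition pr_base : set (set (pixley_roy X)) :=
  [set B | exists F U, open U /\ B = pr_nbhd F U].

Lemma pr_base_cover : \bigcup_(B in pr_base) B = setT.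
Proof.
rewrite -subTset => G _; exists (pr_nbhd G setT).
  by exists G, setT; split=> //; exact: openT.
by split=> //; exact: fsubset_refl.
Qed.

Lemma pr_base_join (A B : set (pixley_roy X)) G :
  pr_base A -> pr_base B -> A G -> B G ->
  exists C, [/\ pr_base C, C G & C `<=` A `&` B].
Proof.
move=> [F [U [oU ->]]] [F' [V [oV ->]]] [FG GU] [F'G GV].
exists (pr_nbhd G (U `&` V)); split.
- by exists G, (U `&` V); split=> //; exact: openI.
- by split; [exact: fsubset_refl | move=> x Gx; split; [exact: GU|exact: GV]].
- move=> H [GH HUV]; split; split.
  + exact: fsubset_trans FG GH.
  + by move=> x /HUV[].
  + exact: fsubset_trans F'G GH.
  + by move=> x /HUV[].
Qed.

HB.instance Definition _ :=
  @isBaseTopological.Build (pixley_roy X) _ pr_base id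
    pr_base_cover pr_base_join.

End PixleyRoy.

(* Convergence is spelled out as the existence of a limit because the notation
   [cvg] is only available on pointed spaces. *)
Definition SHD (Y : topologicalType) : Prop :=
  forall U : nat -> set Y, (forall n, open (U n) /\ U n !=set0) ->
  exists x : nat -> Y, (forall n, U n (x n)) /\
    ~ exists f : nat -> nat, {homo f : m n / (m < n)%N} /\
        exists l : Y, x (f n) @[n --> \oo] --> l.

(* Main.v *)
Require Import Defs.
From HB Require Import structures.
From mathcomp Require Import all_boot finmap.
From mathcomp Require Import all_classical topology.

Local Open Scope classical_set_scope.
Local Open Scope card_scope.

(* A countable family of 0-1 sequences is made convergent by passing to one common
subsequence, which follows the limits along a nonprincipal ultrafilter. Any sequence in the Sigma-product is supported on countably many
coordinates, so the Sigma-product is sequentially compact; and a splitting family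
is uncountable, so kappa is uncountable.

In the Pixley-Roy space, let [F_n, V_n] be contained in U_n, let y_n be a point of
F_n, and let g_0, g_1, ... be distinct coordinates outside the countable set of those
on which some V_n depends near y_n or some member of some F_n differs from p. Let z_n be
y_n flipped at g_0 and g_(n+1), and choose G_n = F_n with z_n added. In G_n only z_n
differs from p at g_0, and the z_n are distinct. If a subsequence of (G_n) converges
to L, then L has a point differing from p at g_0, since otherwise the points equal to p
at g_0 form a neighbourhood of L missing every z_n; but L is eventually contained in
G_n, so this point equals z_n for two different n, a contradiction. *)

Lemma countable_setU (T : Type) (A B : set T) :
  countable A -> countable B -> countable (A `|` B).
Proof.
move=> Act Bct; rewrite -bigcup2E; apply: bigcup_countable; first exact: countableP.
by move=> [|[|n]] _ //=; exact: countable0.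
Qed.

Lemma injection_outside_countable (T : Type) (B : set T) :
  ~ countable [set: T] -> countable B ->
  exists2 g : nat -> T, injective g & forall n, ~ B (g n).
Proof.
move=> Tunct Bct.
have /infiniteP/card_leP[g] : infinite_set (~` B).
  move=> /finite_set_countable BCct; apply: Tunct.
  by rewrite -(setUv B); exact: countable_setU.
exists (fun n => set_val (g (to_setT n))).
  by move=> m n /val_inj /(inj (mem_setT _) (mem_setT _)) [].
by move=> n; exact: (set_valP (g (to_setT n))).
Qed.

(** An injection [j] numbers [A]. The subsequence is built recursively so that its term at [n]
    agrees with the ultrafilter limit [b] at all points numbered below [n]. *)
Lemma pointwise_cvg_subsequence (T : Type) (A : set T) (c : nat -> T -> bool) :
  countable A ->
  exists f : nat -> nat, {homo f : m n / (m < n)%N} /\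
    exists b : T -> bool, forall a, A a -> \forall n \near \oo, c (f n) a = b a.
Proof.
move=> /countable_injP[j jinj].
have [U [ultraU leU]] := ultraFilterLemma eventually_filter.
pose b a := `[< U [set n | c n a] >].
have Ub a : U [set n | c n a = b a].
  rewrite /b; have [Ua|nUa] := asboolP (U _); first exact: Ua.
  have [//|] := in_ultra_setVsetC [set n | c n a] ultraU.
  by apply: filterS => n /= /negP/negbTE.
(* As [j] is injective on [A], at most one point is numbered [k]. *)
have Uk k : U [set n | forall a, A a -> j a = k -> c n a = b a].
  have [[a0 [Aa0 <-]]|noa] := pselect (exists a, A a /\ j a = k).
    apply: filterS (Ub a0) => n cn a Aa jE.
    by rewrite (jinj a a0) ?inE.
  by apply: filterE => n a Aa jE; case: noa; exists a.
have Ule k : U [set n | forall a, A a -> (j a < k)%N -> c n a = b a].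
  elim: k => [|k IHk]; first exact: filterE.
  apply: filterS2 IHk (Uk k) => n H1 H2 a Aa.
  by rewrite ltnS leq_eqVlt => /orP[/eqP/H2|/H1]; exact.
(* Since [U] contains all tails, each of its members has elements beyond [m]. *)
have next m k : exists n, (m < n)%N /\
    forall a, A a -> (j a < k)%N -> c n a = b a.
  apply: (@filter_ex _ U); apply: filterI (Ule k).
  by apply: leU; exists m.+1.
have /choice[g gP] := fun mk : (nat * nat)%type => next mk.1 mk.2.
pose f := fix f n := if n is n'.+1 then g (f n', n'.+1) else g (0, 0).
exists f; split.
  by apply: homo_ltn; [exact: ltn_trans|move=> n /=; case: (gP (f n, n.+1))].
exists b => a Aa; exists (j a).+1 => // -[//|n] /= jn.
by have [_] := gP (f n, n.+1); apply.
Qed.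

(** Were [S] countable, membership in each [B] of [S] would stabilise along one common subsequence
    [f]. The range of [f] would be almost contained in or almost disjoint from every [B], hence
    split by none. *)
Lemma splitting_family_uncountable (S : set (set nat)) :
  splitting_family S -> ~ countable S.
Proof.
move=> [_ split_S] Sct.
have [f [fincr [b fb]]] :=
  pointwise_cvg_subsequence _ _ (fun n B => `[< B n >]) Sct.
have finj : injective f := incn_inj (leq_mono fincr).
have tail_finite (P : set nat) :
    (\forall n \near \oo, ~ P (f n)) -> finite_set (range f `&` P).
  move=> [N _ NP]; apply: (sub_finite_set _ (finite_image f (finite_II N))).
  move=> _ [[n _ <-] Pfn]; exists n => //=; rewrite ltnNge.
  by apply/negP => Nn; exact: NP Nn Pfn.
have [|B [SB infI infD]] := split_S (range f).
  move=> /(finite_preimage (in2W finj)); rewrite preimage_range.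
  exact: infinite_nat.
have {}fb := fb _ SB; case: (b B) fb => fb.
  apply: infD; apply: (tail_finite (~` B)).
  by apply: filterS fb => n /asboolP Bn; apply.
by apply: infI; apply: tail_finite; apply: filterS fb => n /asboolP.
Qed.

Section Sigma_product.
Variables (p : bool) (kappa : Type).
Local Notation X := (Sigma p kappa).

(** The factors are discrete, so eventual equality at each coordinate is enough. *)
Lemma cvg_Sigma (F : set_system X) (l : X) : Filter F ->
  (forall a, F [set z | val z a = val l a]) -> F --> l.
Proof.
move=> FF Fl B [_ [[V oV <-] Vl VB]].
suff : F (set_val @^-1` V) by exact: filterS.
have : (set_val @ F) --> (set_val l : {ptws kappa -> bool}).
  apply/cvg_sup => a C [_ [[D oD <-] Dl DC]].
  apply: (@filterS _ (set_val @ F) _ _ _ DC).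
  have : F [set z | D (set_val z a)]; last exact.
  by apply: filterS (Fl a) => z /= za; rewrite set_valE /= za.
by apply; exact: open_nbhs_nbhs.
Qed.

Lemma nbhs_Sigma_coord (y : X) (a : kappa) :
  nbhs y [set z : X | val z a = val y a].
Proof.
have : nbhs (val y : {ptws kappa -> bool}) [set z | z a = val y a].
  have /cvg_sup/(_ a) : nbhs (val y : {ptws kappa -> bool}) -->
    (val y : {ptws kappa -> bool}) by [].
  apply; exists [set z | z a = val y a]; split=> //.
  by exists [set val y a] => //; exact: discrete_open.
exact: (@initial_continuous _ _ (set_val : X -> {ptws kappa -> bool}) y).
Qed.

Lemma nbhs_Sigma_finite_support (y : X) (V : set X) : nbhs y V ->
  exists2 K : set kappa, finite_set K &
    forall z : X, (forall a, K a -> val z a = val y a) -> V z.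
Proof.
(* The filter generated by these sets for finite [K] converges to [y] coordinatewise, so it contains
   every neighbourhood of [y]. *)
pose E (K : set kappa) := [set z : X | forall a, K a -> val z a = val y a].
have FE : Filter (filter_from finite_set E).
  apply: filter_from_filter; first by exists set0.
  move=> K L fK fL; exists (K `|` L); first by rewrite finite_setU.
  by move=> z zKL; split=> a Ka; apply: zKL; [left|right].
move: V; apply: cvg_Sigma => a; exists [set a] => // z; exact.
Qed.

Lemma Sigma_cvg_subsequence (x : nat -> X) :
  exists f : nat -> nat, {homo f : m n / (m < n)%N} /\
    exists l : X, x (f n) @[n --> \oo] --> l.
Proof.
pose A := \bigcup_n [set a | val (x n) a <> p].
have Act : countable A.
  by apply: bigcup_countable => // n _; exact: (set_valP (x n)).
have [f [fincr [b fb]]] :=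
  pointwise_cvg_subsequence _ _ (fun n a => val (x n) a) Act.
exists f; split => //.
(* Off [A] every term equals [p]; this choice keeps the support of the limit inside [A]. *)
pose l a := if `[< A a >] then b a else p.
have lX : Sigma_set p l.
  apply: sub_countable Act; apply: subset_card_le => a /=.
  by rewrite /l; case: asboolP.
exists (exist _ l (mem_set lX)); apply: cvg_Sigma => a /=.
rewrite /l; case: asboolP => [/fb //|nAa].
apply: filterE => n /=; apply: contrapT => xa; apply: nAa.
by exists (f n).
Qed.

Lemma Sigma_not_SHD : ~ SHD X.
Proof.
move=> /(_ (fun=> setT))[n|x [_]]; last by apply; exact: Sigma_cvg_subsequence.
split; first exact: openT.
have cX : @Sigma_set p kappa (fun=> p).
  apply: sub_countable (countable0 kappa); apply: subset_card_le.
  by move=> a /=; exact.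
by exists (exist _ (fun=> p) (mem_set cX)).
Qed.

End Sigma_product.

Section Pixley_Roy.
Variable X : topologicalType.

Lemma open_pr_nbhd (F : pixley_roy X) (U : set X) : open U -> open (pr_nbhd F U).
Proof.
move=> oU; exists [set pr_nbhd F U]; last exact: bigcup_set1.
by move=> _ ->; exists F, U.
Qed.

Lemma nbhs_pr_nbhd (F : pixley_roy X) (U : set X) :
  open U -> [set` val F] `<=` U -> nbhs F (pr_nbhd F U).
Proof.
move=> oU FU; apply: open_nbhs_nbhs; split; first exact: open_pr_nbhd.
by split=> //; exact: fsubset_refl.
Qed.

Lemma open_pr_nbhd_sub (V : set (pixley_roy X)) (F : pixley_roy X) :
  open V -> V F -> exists U, [/\ open U, [set` val F] `<=` U & pr_nbhd F U `<=` V].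
Proof.
move=> [D DB <-] [B DBB BF]; have [G [U [oU BE]]] := DB _ DBB.
(* A basic set [[G, U]] containing [F] has [G] inside [F], so it contains [[F, U]]. *)
move: BF; rewrite BE => -[GF FU]; exists U; split => // H [FH HU].
by exists B => //; rewrite BE; split=> //; exact: fsubset_trans FH.
Qed.

End Pixley_Roy.

Section Pixley_Roy_Sigma.
Variables (p : bool) (kappa : Type).
Local Notation X := (Sigma p kappa).

(** In the application [a] is the marker common to all new points and [b] tells them apart. *)
Lemma Sigma_flip (y : X) (a b : kappa) : exists z : X,
  forall c, val z c = if `[< c = a \/ c = b >] then ~~ p else val y c.
Proof.
pose z c := if `[< c = a \/ c = b >] then ~~ p else val y c.
have zX : Sigma_set p z.
  have : countable ([set c | val y c <> p] `|` [set a; b]).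
    apply: countable_setU; first exact: (set_valP y).
    by apply: countable_setU; exact: countable1.
  apply: sub_countable; apply: subset_card_le => c /=.
  by rewrite /z; case: asboolP => [|_]; [right|left].
by exists (exist _ z (mem_set zX)).
Qed.

Lemma pixley_roy_Sigma_SHD : ~ countable [set: kappa] -> SHD (pixley_roy X).
Proof.
move=> kappa_unct U Uop.
have /choice[F FU] n : exists F : pixley_roy X, U n F.
  by case: (Uop n).2 => F; exists F.
have /choice[V VP] n := open_pr_nbhd_sub _ _ _ (Uop n).1 (FU n).
have /choice[y yF] n : exists y, y \in val (F n).
  by apply/fset0Pn; exact: (valP (F n)).
have /choice[K KP] n : exists K : set kappa, finite_set K /\
    forall z : X, (forall a, K a -> val z a = val (y n) a) -> V n z.
  have [oV FV _] := VP n.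
  have [K Kfin KV] := nbhs_Sigma_finite_support _ _ (y n) (V n)
    (open_nbhs_nbhs (conj oV (FV _ (yF n)))).
  by exists K.
pose B := \bigcup_n (K n `|` \bigcup_(x in [set` val (F n)])
  [set a | val x a <> p]).
have Bct : countable B.
  apply: bigcup_countable => // n _; apply: countable_setU.
    by apply: finite_set_countable; case: (KP n).
  apply: bigcup_countable; first exact: countable_fset.
  by move=> x _; exact: (set_valP x).
have [g ginj gB] := injection_outside_countable _ _ kappa_unct Bct.
have gF n x m : x \in val (F n) -> val x (g m) = p.
  move=> xF; apply: contrapT => xg; apply: (gB m).
  by exists n => //; right; exists x.
have /choice[z zE] n := Sigma_flip (y n) (g 0) (g n.+1).
have z0 n : val (z n) (g 0) = ~~ p.
  by rewrite zE; case: asboolP => // -[]; left.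
(* The flipped coordinates avoid [K n]. *)
have zV n : V n (z n).
  apply: (KP n).2 => a Ka; rewrite zE; case: asboolP => // ag.
  have [k ak] : exists k, a = g k by case: ag => ->; [exists 0|exists n.+1].
  by case: (gB k); exists n => //; left; rewrite -ak.
have Gne n : (z n |` val (F n))%fset != fset0.
  by apply/fset0Pn; exists (z n); rewrite !inE eqxx.
pose G n : pixley_roy X := exist _ (z n |` val (F n))%fset (Gne n).
exists G; split => [n|[f [fincr [l Gl]]]].
  have [_ FV] := VP n; apply; split; first exact: fsubsetU1.
  by move=> x /=; rewrite !inE => /orP[/eqP ->//|/FV].
have [[x xl xp]|nox] :=
  pselect (exists2 x : X, x \in val l & val x (g 0) <> p).
  (* Only the inclusion of [l] in [G (f n)] is wanted, so the upper bound is the whole space. *)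
  have lT : nbhs l (pr_nbhd l setT) by apply: nbhs_pr_nbhd => //; exact: openT.
  have [N _ NG] := Gl _ lT.
  have xz n : (N <= n)%N -> x = z (f n).
    move=> /NG[/fsubsetP/(_ _ xl)]; rewrite !inE => /orP[/eqP //|/gF xF].
    by case: xp; exact: xF.
  (* At this coordinate [z (f N)] is flipped, while [z (f N.+1)] keeps the value [p] of its base
     point. *)
  have : val (z (f N)) (g (f N).+1) = val (z (f N.+1)) (g (f N).+1).
    by rewrite -!xz.
  rewrite !zE; case: asboolP => [_|[]]; last by right.
  case: asboolP => [[/ginj//|/ginj[] fE]|_].
    by have := fincr _ _ (ltnSn N); rewrite fE ltnn.
  by rewrite (gF _ _ _ (yF _)) => /eqP; rewrite eqb_negLR; case: p.
pose W := [set x : X | val x (g 0) = p].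
have oW : open W.
  rewrite openE => x Wx; rewrite /interior.
  by apply: filterS (nbhs_Sigma_coord _ _ x (g 0)) => w /= wx; rewrite /W /= wx.
have lW : [set` val l] `<=` W.
  by move=> x /= xl; apply: contrapT => xp; apply: nox; exists x.
have [N _ NG] := Gl _ (nbhs_pr_nbhd _ _ _ oW lW).
have [_ /(_ (z (f N)))] := NG N (leqnn N).
by rewrite /= !inE eqxx /W /= z0 => /(_ isT); case: p.
Qed.

End Pixley_Roy_Sigma.

Theorem corollary4 (s kappa : Type) (hs : is_splitting_number s)
    (hkappa : [set: s] #<= [set: kappa]) (p : bool) :
  ~ SHD (Sigma p kappa) /\ SHD (pixley_roy (Sigma p kappa)).
Proof.
split; first exact: Sigma_not_SHD.
apply: pixley_roy_Sigma_SHD => kappa_ct; have [[S splitS cardS] _] := hs.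
apply: (splitting_family_uncountable S splitS).
apply: card_le_trans (card_le_trans hkappa kappa_ct).
by move: cardS; rewrite card_eq_le => /andP[].
Qed.
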